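(* Let $L\ge 1$ be an integer and $0<\alpha<1$. Let $\Omega\subset\{0,1\}^L$ be an irreducible component of the Markov chain $(v^n)_{n\ge0}$ on $\{0,1\}^L$ described in the context, and let $p=p_\Omega$ be the unique stationary probability measure supported on $\Omega$. Then for every $x\in\Omega$, $$p(x)=\frac{\dfrac{\alpha^{\#010(x)}}{(1-\alpha)^{\#1110(x)+\#010(x)}}}{\displaystyle\sum_{k_1,k_2\ge 0}\frac{\alpha^{k_2}}{(1-\alpha)^{k_1+k_2}}\,N_\Omega(k_1,k_2)},$$ where $N_\Omega(k_1,k_2)$ is the number of configurations $x\in\Omega$ with $\#1110(x)=k_1$ and $\#010(x)=k_2$.
   Context: Configurations are $x=(x_j)_{j=1}^L\in\{0,1\}^L$ with site indices taken modulo $L$ (periodic boundary). For a word $a_1\cdots a_k$ in $\{0,1\}$, $\#a_1\cdots a_k(x)$ is the number of sites $j\in\{1,\dots,L\}$ with $x_jx_{j+1}\cdots x_{j+k-1}=a_1\cdots a_k$ (indices mod $L$). Markov chain: $v_j^{n+1}=v_j^n+q_{j-1}^n-q_j^n$, where $q_j^n=q(v_{j-2}^n,v_{j-1}^n,v_j^n,v_{j+1}^n)$ is the flux from site $j$ to site $j+1$, with $q(0,0,1,0)=q(1,0,1,0)=1$, $q(1,1,1,0)=b$, and $q(w,x,y,z)=0$ for all other arguments. Here $b=b_j^n$ equals $1$ with probability $\alpha$ and $0$ with probability $1-\alpha$, independently for different sites $j$ and times $n$ (the same realized value $q_j^n$ is used in the updates of sites $j$ and $j+1$). In words, simultaneously: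 an isolated particle ($010$) moves one site right; a block of exactly two particles ($0110$) does not move; in a block of at least three particles the rightmost one moves one site right with probability $\alpha$, and the others stay. $f_n(x',x)$ is the $n$-step transition probability from $x'$ to $x$, and $f=f_1$. A set $\Omega$ is irreducible if for all $x',x\in\Omega$ there is $n\ge0$ with $f_n(x',x)>0$; an irreducible component is a maximal irreducible set (communicating class). A probability vector $p$ is stationary if $\sum_{x'}f(x',x)p(x')=p(x)$ for all $x\in\{0,1\}^L$. *)

(* Defs.v *)
From mathcomp Require Import all_boot all_order all_algebra.

Set Implicit Arguments.
Unset Strict Implicit.
Unset Printing Implicit Defensive.

Import Order.TTheory GRing.Theory Num.Theory.
Local Open Scope ring_scope.

(* Sites form the cycle 'I_L: [ordS] and [ord_pred] are j + 1 and j - 1 mod L. *)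
Definition config (L : nat) := {ffun 'I_L -> bool}.

Definition occ (L : nat) (w : seq bool) (x : config L) : nat :=
  #|[set j : 'I_L | mkseq (fun i => x (iter i (@ordS L) j)) (size w) == w]|.

Definition n010 (L : nat) (x : config L) : nat :=
  occ [:: false; true; false] x.

Definition n1110 (L : nat) (x : config L) : nat :=
  occ [:: true; true; true; false] x.

Definition q (b w x y z : bool) : bool :=
  match w, x, y, z with
  | false, false, true, false => true
  | true, false, true, false => true
  | true, true, true, false => b
  | _, _, _, _ => false
  end.

Definition flux (L : nat) (b : {ffun 'I_L -> bool}) (v : config L) (j : 'I_L) :
    bool :=
  q (b j) (v (ord_pred (ord_pred j))) (v (ord_pred j)) (v j) (v (ordS j)).

(* The new occupation number v_j + q_{j-1} - q_j is always 0 or 1, and the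
   subtraction on nat never truncates: see [stepE]. *)
Definition step (L : nat) (b : {ffun 'I_L -> bool}) (v : config L) : config L :=
  [ffun j => (v j + flux b v (ord_pred j) - flux b v j == 1)%N].

Lemma stepE (L : nat) (b : {ffun 'I_L -> bool}) (v : config L) (j : 'I_L) :
  (step b v j : nat)%:Z
    = (v j : nat)%:Z + (flux b v (ord_pred j) : nat)%:Z - (flux b v j : nat)%:Z.
Proof.
rewrite /step ffunE /flux ord_predK.
by case: (b j); case: (b (ord_pred j)); case: (v (ordS j)); case: (v j);
   case: (v (ord_pred j)); case: (v (ord_pred (ord_pred j)));
   case: (v (ord_pred (ord_pred (ord_pred j)))).
Qed.

Section Chain.

Variables (R : realFieldType) (L : nat) (alpha : R).

(* The law of L independent Bernoulli(alpha) variables, one per site. *)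
Definition bernoulli_weight (b : {ffun 'I_L -> bool}) : R :=
  \prod_(j < L) (if b j then alpha else 1 - alpha).

Definition f (x' x : config L) : R :=
  \sum_(b : {ffun 'I_L -> bool} | step b x' == x) bernoulli_weight b.

Fixpoint fn (n : nat) (x' x : config L) : R :=
  if n is m.+1 then \sum_(y : config L) fn m x' y * f y x
  else (x' == x)%:R.

Definition irreducible (Omega : {set config L}) : Prop :=
  forall x' x, x' \in Omega -> x \in Omega -> exists n : nat, 0 < fn n x' x.

Definition irreducible_component (Omega : {set config L}) : Prop :=
  irreducible Omega /\
  forall Omega' : {set config L},
    irreducible Omega' -> Omega \subset Omega' -> Omega' = Omega.

Definition probability_vector (p : {ffun config L -> R}) : Prop :=
  (forall x, 0 <= p x) /\ \sum_(x : config L) p x = 1.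

Definition stationary (p : {ffun config L -> R}) : Prop :=
  probability_vector p /\
  forall x : config L, \sum_(x' : config L) f x' x * p x' = p x.

Definition stationary_on (Omega : {set config L}) (p : {ffun config L -> R}) :
    Prop :=
  stationary p /\ forall x : config L, x \notin Omega -> p x = 0.

End Chain.

Definition N (L : nat) (Omega : {set config L}) (k1 k2 : nat) : nat :=
  #|[set x in Omega | (n1110 x == k1) && (n010 x == k2)]|.

(* Hence a sum over all k1, k2 >= 0 weighted by [N] is the sum over
   0 <= k1, k2 <= L. *)
Lemma N_eq0 (L : nat) (Omega : {set config L}) (k1 k2 : nat) :
  (L < k1)%N || (L < k2)%N -> N Omega k1 k2 = 0%N.
Proof.
have occ_le w (x : config L) : (occ w x <= L)%N.
  by rewrite -[leqRHS]card_ord max_card.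
move=> k_gt; apply/eqP; rewrite cards_eq0 -subset0; apply/subsetP=> x.
rewrite !inE => /and3P[_ /eqP k1E /eqP k2E]; move: k_gt.
by rewrite -k1E -k2E !ltnNge !occ_le.
Qed.

(* Main.v *)
(** In the weight [w x = alpha^#010 / (1 - alpha)^(#1110 + #010)], a transition
    from [x'] along the realized flux [phi] carries the mass
    [w x' * P(phi | x') = rho^|phi|], with [rho = alpha / (1 - alpha)].  A flux
    pattern is possible out of [x'] exactly when, read from right to left, it is
    possible out of its image [x]: isolated particles of [x] must have jumped, and
    only those and first particles of blocks of length at least three can have
    jumped.  Hence the mass entering [x] is the sum of [rho^|phi|] over the
    reflected possible patterns of [x], which is
    [rho^#010 * (1 + rho)^#0111 = w x].  A positive stationary
    vector makes accessibility symmetric, so a communicating class is closed, and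
    a stationary vector on it is unique up to a scalar. *)
Require Import Defs.
From mathcomp Require Import all_boot all_order all_algebra.
From mathcomp Require Import ring.

Set Implicit Arguments.
Unset Strict Implicit.
Unset Printing Implicit Defensive.

Import Order.TTheory GRing.Theory Num.Theory.
Local Open Scope ring_scope.

(** * Finite Markov chains *)

(** If no edge leaves a set, stationarity preserves its mass, so nothing flows in; as [w] is
    positive, no edge enters. For the set reachable from [y], this turns an edge from [x] to [y]
    into a path back. *)
Lemma positive_stationary_connect_sym (R : realFieldType) (T : finType)
    (P : T -> T -> R) (w : T -> R) :
  (forall x y, 0 <= P x y) -> (forall x, \sum_y P x y = 1) ->
  (forall x, 0 < w x) -> (forall y, \sum_x P x y * w x = w y) ->
  connect_sym [rel x y | 0 < P x y].
Proof.
move=> P_ge0 P_sum1 w_gt0 w_stat.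
set e := [rel x y | 0 < P x y].
have closed_back (A : {set T}) :
    (forall x y, x \in A -> y \notin A -> P x y = 0) ->
    forall x y, x \notin A -> y \in A -> P x y = 0.
  move=> closA x y xNA yA.
  (* The mass of [A] after one step is the old mass, all of which stays in [A], plus the inflow from
     outside, which must therefore vanish term by term. *)
  have : \sum_(z in A) w z =
      \sum_(z in A) w z + \sum_(u | u \notin A) \sum_(z in A) P u z * w u.
    transitivity (\sum_(z in A) \sum_u P u z * w u).
      by apply: eq_bigr => z _; rewrite w_stat.
    rewrite exchange_big /= (bigID (mem A)) /=; congr (_ + _).
    apply: eq_bigr => u uA; rewrite -mulr_suml -[RHS]mul1r -(P_sum1 u).
    congr (_ * _); rewrite [RHS](bigID (mem A)) /= [X in _ + X]big1 ?addr0 //.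
    by move=> z zNA; apply: closA.
  move=> /eqP; rewrite -subr_eq0 opprD addrA subrr sub0r oppr_eq0.
  have term_ge0 u z : 0 <= P u z * w u by rewrite mulr_ge0 // ltW.
  rewrite psumr_eq0; last by move=> u _; apply: sumr_ge0.
  move/allP/(_ x (mem_index_enum x)); rewrite xNA /= psumr_eq0 //.
  move/allP/(_ y (mem_index_enum y)); rewrite yA /= mulf_eq0.
  by rewrite (gt_eqF (w_gt0 x)) orbF => /eqP.
have edge_back x y : e x y -> connect e y x.
  move=> exy; pose A := [set z | connect e y z].
  suff : x \in A by rewrite inE.
  apply: contraTT exy => xNA.
  rewrite /= (closed_back A) ?ltxx //; last by rewrite inE connect0.
  move=> u v; rewrite !inE => yu yNv; apply: contraNeq yNv => Puv.
  by apply: connect_trans yu (connect1 _); rewrite /= lt_def Puv P_ge0.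
have conn_back x y : connect e x y -> connect e y x.
  move=> /connectP [s]; elim: s x => [|z s IHs] x /= => [_ ->|].
    exact: connect0.
  move=> /andP [exz zs] yE.
  exact: connect_trans (IHs _ zs yE) (edge_back _ _ exz).
by move=> x y; apply/idP/idP; apply: conn_back.
Qed.

(** A zero of [h] is a vanishing sum of nonnegative inflows, so zeros propagate backwards along
    edges. *)
Lemma stationary_zero_connect (R : realFieldType) (T : finType)
    (P : T -> T -> R) (h : T -> R) (x y : T) :
  (forall x y, 0 <= P x y) -> (forall x, 0 <= h x) ->
  (forall y, \sum_x P x y * h x = h y) ->
  connect [rel x y | 0 < P x y] x y -> h y = 0 -> h x = 0.
Proof.
move=> P_ge0 h_ge0 h_stat /connectP [s].
elim: s x => [|z s IHs] x /= => [_ -> //|/andP [Pxz zs] yE hy0].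
have /eqP := IHs z zs yE hy0; rewrite -h_stat psumr_eq0; last first.
  by move=> u _; apply: mulr_ge0.
move/allP/(_ x (mem_index_enum x)).
by rewrite /= mulf_eq0 (gt_eqF Pxz) => /eqP.
Qed.

(** Subtract from [p] the largest multiple of [u] that leaves it nonnegative on [A]: the difference
    is stationary and vanishes at a minimiser of [p / u], hence everywhere. *)
Lemma stationary_proportional (R : realFieldType) (T : finType)
    (P : T -> T -> R) (A : {set T}) (u p : T -> R) (x0 : T) :
  (forall x y, 0 <= P x y) -> x0 \in A ->
  (forall x y, x \in A -> y \in A -> connect [rel x y | 0 < P x y] x y) ->
  (forall x, x \in A -> 0 < u x) ->
  (forall x, x \notin A -> u x = 0) -> (forall x, x \notin A -> p x = 0) ->
  (forall y, \sum_x P x y * u x = u y) ->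
  (forall y, \sum_x P x y * p x = p y) ->
  exists c, forall x, p x = c * u x.
Proof.
move=> P_ge0 x0A conA u_gt0 u0 p0 u_stat p_stat.
have [m mA m_min] := arg_minP (fun x => p x / u x) x0A.
exists (p m / u m) => x; apply/eqP; rewrite -subr_eq0; apply/eqP.
have [xA|xNA] := boolP (x \in A);
  last by rewrite (p0 _ xNA) (u0 _ xNA) mulr0 subr0.
apply: (@stationary_zero_connect R T P (fun x => p x - p m / u m * u x) x m) => //.
- move=> y; have [yA|yNA] := boolP (y \in A); last first.
    by rewrite (p0 _ yNA) (u0 _ yNA) mulr0 subr0.
  by rewrite subr_ge0 -ler_pdivlMr ?u_gt0 // m_min.
- move=> y; rewrite -(p_stat y) -(u_stat y) mulr_sumr -sumrB.
  by apply: eq_bigr => z _; ring.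
- exact: conA.
- by rewrite divfK ?subrr // gt_eqF // u_gt0.
Qed.

(** * Reversal of the flux *)

(** Since [q] is monotone in its noise bit, this says that some value of the bit produces the flux
    [c]. *)
Definition admissible (c w x y z : bool) : bool :=
  (q false w x y z ==> c) && (c ==> q true w x y z).

Definition forward_admissible (L : nat) (phi : {ffun 'I_L -> bool})
    (x : config L) : bool :=
  [forall j, admissible (phi j) (x (ord_pred (ord_pred j))) (x (ord_pred j))
                        (x j) (x (ordS j))].

(** In the mirror image, the particle crossing the bond between [j] and [ordS j] starts from
    [ordS j], so the window is read from [j + 3] down to [j]. *)
Definition backward_admissible (L : nat) (phi : {ffun 'I_L -> bool})
    (x : config L) : bool :=
  [forall j, admissible (phi j) (x (ordS (ordS (ordS j)))) (x (ordS (ordS j)))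
                        (x (ordS j)) (x j)].

Definition push (L : nat) (phi : {ffun 'I_L -> bool}) (x : config L) : config L :=
  [ffun j => (x j + phi (ord_pred j) - phi j == 1)%N].

Definition pull (L : nat) (phi : {ffun 'I_L -> bool}) (x : config L) : config L :=
  [ffun j => (x j + phi j - phi (ord_pred j) == 1)%N].

(* [a0 ... a7] are consecutive sites and [c0 ... c4] the fluxes out of [a2 ... a6];
   the statement is used both as it stands and read from right to left. *)
Lemma admissible_reverse (a0 a1 a2 a3 a4 a5 a6 a7 c0 c1 c2 c3 c4 : bool) :
  admissible c0 a0 a1 a2 a3 -> admissible c1 a1 a2 a3 a4 ->
  admissible c2 a2 a3 a4 a5 -> admissible c3 a3 a4 a5 a6 ->
  admissible c4 a4 a5 a6 a7 ->
  admissible c1 (a6 + c3 - c4 == 1)%N (a5 + c2 - c3 == 1)%N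
             (a4 + c1 - c2 == 1)%N (a3 + c0 - c1 == 1)%N.
Proof.
(* Each flux is split as soon as its window is known, so that inadmissible values are discarded
   early. *)
by case: a0; case: a1; case: a2; case: a3; case: c0 => //;
   case: a4; case: c1 => //; case: a5; case: c2 => //;
   case: a6; case: c3 => //; case: a7; case: c4.
Qed.

(** Admissibility allows inflow only into an empty site and outflow only from an occupied one, so
    the truncated subtraction loses nothing. Serves both reading directions. *)
Lemma admissible_cancel (a0 a1 a2 a3 a4 c0 c1 : bool) :
  admissible c0 a0 a1 a2 a3 -> admissible c1 a1 a2 a3 a4 ->
  ((a3 + c0 - c1 == 1)%N + c1 - c0 == 1)%N = a3.
Proof.
by case: a0; case: a1; case: a2; case: a3; case: c0 => //;
   case: a4; case: c1.
Qed.

Lemma backward_admissible_push (L : nat) (phi : {ffun 'I_L -> bool})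
    (x : config L) :
  forward_admissible phi x -> backward_admissible phi (push phi x).
Proof.
move=> /forallP adm; apply/forallP => j; rewrite !ffunE !ordSK.
have := adm (ord_pred j); have := adm j; have := adm (ordS j).
have := adm (ordS (ordS j)); have := adm (ordS (ordS (ordS j))).
rewrite !ordSK !ord_predK => h4 h3 h2 h1 h0.
exact: admissible_reverse h0 h1 h2 h3 h4.
Qed.

Lemma forward_admissible_pull (L : nat) (phi : {ffun 'I_L -> bool})
    (x : config L) :
  backward_admissible phi x -> forward_admissible phi (pull phi x).
Proof.
move=> /forallP adm; apply/forallP => j; rewrite !ffunE !ordSK.
have := adm (ordS j); have := adm j; have := adm (ord_pred j).
have := adm (ord_pred (ord_pred j)).
have := adm (ord_pred (ord_pred (ord_pred j))).
rewrite !ord_predK => h4 h3 h2 h1 h0.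
exact: admissible_reverse h0 h1 h2 h3 h4.
Qed.

Lemma pushK (L : nat) (phi : {ffun 'I_L -> bool}) (x : config L) :
  forward_admissible phi x -> pull phi (push phi x) = x.
Proof.
move=> /forallP adm; apply/ffunP => j; rewrite !ffunE.
have := adm j; have := adm (ord_pred j); rewrite ord_predK.
exact: admissible_cancel.
Qed.

Lemma pullK (L : nat) (phi : {ffun 'I_L -> bool}) (x : config L) :
  backward_admissible phi x -> push phi (pull phi x) = x.
Proof.
move=> /forallP adm; apply/ffunP => j; rewrite !ffunE.
have := adm (ord_pred j); have := adm j; rewrite !ord_predK.
exact: admissible_cancel.
Qed.

(** For fixed [phi], [push] and [pull] are inverse bijections; in this form a sum over [x']
    collapses to one term. *)
Lemma forward_push_eq (L : nat) (phi : {ffun 'I_L -> bool}) (x x' : config L) :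
  forward_admissible phi x' && (push phi x' == x) =
  backward_admissible phi x && (x' == pull phi x).
Proof.
apply/andP/andP => - [adm /eqP E].
  by rewrite -E backward_admissible_push ?pushK.
by rewrite E forward_admissible_pull ?pullK.
Qed.

(** * The weight *)

Lemma occE (L : nat) (w : seq bool) (x : config L) :
  occ w x =
  (\sum_(j < L) (mkseq (fun i => x (iter i (@ordS L) j)) (size w) == w))%N.
Proof.
by rewrite /occ -sum1_card big_mkcond; apply: eq_bigr => j _; rewrite inE.
Qed.

(* Adding #1111 to either side gives #111. *)
Lemma occ0111 (L : nat) (x : config L) :
  occ [:: false; true; true; true] x = n1110 x.
Proof.
rewrite /n1110; apply/eqP.
rewrite -(eqn_add2r (occ [:: true; true; true; true] x)) !occE -!big_split /=.
(* The run 111 starts at the second letter of the left window but at the first of the right one,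
   hence a shift by one site. *)
apply/eqP; rewrite [RHS](reindex_inj (can_inj (@ordSK L))) /=.
have E b0 b1 b2 b3 : (([:: b0; b1; b2; b3] == [:: false; true; true; true])%B +
    ([:: b0; b1; b2; b3] == [:: true; true; true; true])%B)%N = [&& b1, b2 & b3] :> nat.
  by case: b0; case: b1; case: b2; case: b3.
have E' b0 b1 b2 b3 : (([:: b0; b1; b2; b3] == [:: true; true; true; false])%B +
    ([:: b0; b1; b2; b3] == [:: true; true; true; true])%B)%N = [&& b0, b1 & b2] :> nat.
  by case: b0; case: b1; case: b2; case: b3.
by apply: eq_bigr => j _; rewrite /mkseq /= E E'.
Qed.

Definition weight (R : realFieldType) (alpha : R) (L : nat) (x : config L) : R :=
  alpha ^+ n010 x / (1 - alpha) ^+ (n1110 x + n010 x).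

(** With [rho = alpha / (1 - alpha)], this is the sum of [rho ^+ c] over admissible [c]: [rho] for a
    forced jump, [1 + rho] for an optional one, 1 for none. *)
Definition local_weight (R : realFieldType) (alpha : R) (w x y z : bool) : R :=
  if q false w x y z then alpha / (1 - alpha)
  else if q true w x y z then (1 - alpha)^-1 else 1.

Lemma local_weightE (R : realFieldType) (alpha : R) (w x y z : bool) :
  local_weight alpha w x y z =
  (alpha / (1 - alpha)) ^+ ([:: x; y; z] == [:: false; true; false]) *
  (1 - alpha)^-1 ^+ ([:: w; x; y; z] == [:: true; true; true; false]).
Proof.
by case: w; case: x; case: y; case: z; rewrite /local_weight /= ?expr0 ?expr1 ?mulr1 ?mul1r.
Qed.

Lemma weight_gt0 (R : realFieldType) (alpha : R) (L : nat) (x : config L) :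
  0 < alpha < 1 -> 0 < weight alpha x.
Proof.
by move=> /andP [a0 a1]; rewrite divr_gt0 // exprn_gt0 // subr_gt0.
Qed.

Lemma weight_expE (R : realFieldType) (alpha : R) (L : nat) (x : config L) :
  weight alpha x =
  (alpha / (1 - alpha)) ^+ n010 x * (1 - alpha)^-1 ^+ n1110 x.
Proof. by rewrite /weight expr_div_n exprVn exprD invfM; ring. Qed.

Lemma weight_forward (R : realFieldType) (alpha : R) (L : nat) (x : config L) :
  weight alpha x =
  \prod_j local_weight alpha (x (ord_pred (ord_pred j))) (x (ord_pred j))
                       (x j) (x (ordS j)).
Proof.
under eq_bigr => j _ do rewrite local_weightE.
rewrite big_split /= -!expr_sum weight_expE /n010 /n1110 !occE.
congr (_ ^+ _ * _ ^+ _).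
  rewrite (reindex_inj (can_inj (@ord_predK L))) /=; apply: eq_bigr => j _.
  by rewrite /mkseq /= !ord_predK.
rewrite (reindex_inj (can_inj (@ord_predK L))) /=.
rewrite (reindex_inj (can_inj (@ord_predK L))) /=; apply: eq_bigr => j _.
by rewrite /mkseq /= !ord_predK.
Qed.

(** Reversal fixes 010 and turns 1110 into 0111, whose count is the same by [occ0111]. *)
Lemma weight_backward (R : realFieldType) (alpha : R) (L : nat) (x : config L) :
  weight alpha x =
  \prod_j local_weight alpha (x (ordS (ordS (ordS j)))) (x (ordS (ordS j)))
                       (x (ordS j)) (x j).
Proof.
under eq_bigr => j _ do rewrite local_weightE.
rewrite big_split /= -!expr_sum weight_expE -occ0111 /n010 !occE.
congr (_ ^+ _ * _ ^+ _); apply: eq_bigr => j _; rewrite /mkseq /=.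
  by case: (x j); case: (x (ordS j)); case: (x (ordS (ordS j))).
by case: (x j); case: (x (ordS j)); case: (x (ordS (ordS j)));
   case: (x (ordS (ordS (ordS j)))).
Qed.

Lemma local_forward_mass (R : realFieldType) (alpha : R) (c w x y z : bool) :
  alpha != 1 ->
  (\sum_(b : bool | q b w x y z == c) (if b then alpha else 1 - alpha)) *
    local_weight alpha w x y z =
  (admissible c w x y z)%:R * (alpha / (1 - alpha)) ^+ c.
Proof.
rewrite eq_sym -subr_eq0 => a1; rewrite big_mkcond big_bool.
by case: w; case: x; case: y; case: z; case: c;
   rewrite /local_weight /admissible /= ?expr0 ?expr1; field.
Qed.

Lemma local_backward_mass (R : realFieldType) (alpha : R) (w x y z : bool) :
  alpha != 1 ->
  \sum_(c : bool) (admissible c w x y z)%:R * (alpha / (1 - alpha)) ^+ c =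
  local_weight alpha w x y z.
Proof.
rewrite eq_sym -subr_eq0 => a1; rewrite big_bool.
by case: w; case: x; case: y; case: z;
   rewrite /local_weight /admissible /= ?expr0 ?expr1; field.
Qed.

Lemma natr_forall (R : realFieldType) (I : finType) (P : pred I) :
  ([forall i, P i])%:R = \prod_i (P i)%:R :> R.
Proof.
have [/forallP h|] := boolP [forall i, P i]; first by rewrite big1 // => i _; rewrite h.
rewrite negb_forall => /existsP [i Pi].
by rewrite (bigD1 i) //= (negbTE Pi) mul0r.
Qed.

(** The flux at [j] sees the noise only through [b j], so the law of the flux pattern factorises
    over sites, as the weight does. *)
Lemma forward_mass (R : realFieldType) (alpha : R) (L : nat)
    (phi : {ffun 'I_L -> bool}) (x : config L) :
  alpha != 1 ->
  (\sum_(b : {ffun 'I_L -> bool} | finfun (flux b x) == phi)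
     bernoulli_weight alpha b) * weight alpha x =
  (forward_admissible phi x)%:R * \prod_j (alpha / (1 - alpha)) ^+ phi j.
Proof.
move=> a1; rewrite natr_forall -big_split /=.
under [RHS]eq_bigr => j _ do rewrite -local_forward_mass //.
rewrite big_split /= -weight_forward; congr (_ * _).
rewrite bigA_distr_big_dep /=.
apply: eq_bigl => b; apply/eqP/forallP => [<- j|E].
  by rewrite unfold_in ffunE.
by apply/ffunP => j; have := E j; rewrite ffunE unfold_in => /eqP.
Qed.

Lemma backward_mass (R : realFieldType) (alpha : R) (L : nat) (x : config L) :
  alpha != 1 ->
  \sum_(phi : {ffun 'I_L -> bool})
    (backward_admissible phi x)%:R * \prod_j (alpha / (1 - alpha)) ^+ phi j =
  weight alpha x.
Proof.
move=> a1; rewrite weight_backward.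
under [RHS]eq_bigr => j _ do rewrite -local_backward_mass //.
rewrite bigA_distr_bigA /=; apply: eq_bigr => phi _.
by rewrite natr_forall -big_split.
Qed.

Lemma weight_stationary (R : realFieldType) (alpha : R) (L : nat) (x : config L) :
  alpha != 1 -> \sum_x' f alpha x' x * weight alpha x' = weight alpha x.
Proof.
move=> a1; rewrite -[RHS]backward_mass //.
have stepE b (v : config L) : step b v = push (finfun (flux b v)) v.
  by apply/ffunP => j; rewrite !ffunE.
(* Noise patterns are grouped by the flux [phi] they realise, along which [step] acts as
   [push phi]. *)
transitivity (\sum_(x' : config L) \sum_(phi : {ffun 'I_L -> bool})
    (forward_admissible phi x' && (push phi x' == x))%:R *
    \prod_j (alpha / (1 - alpha)) ^+ phi j).
  apply: eq_bigr => x' _.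
  rewrite /f (partition_big (fun b => finfun (flux b x')) predT) //= mulr_suml.
  apply: eq_bigr => phi _.
  have [E|nE] := boolP (push phi x' == x); last first.
    rewrite andbF mul0r big_pred0 ?mul0r // => b; rewrite stepE.
    by have [->|] := eqVneq (finfun (flux b x')) phi; rewrite ?(negbTE nE) ?andbF.
  rewrite andbT -forward_mass //; congr (_ * _); apply: eq_bigl => b.
  by rewrite stepE; have [->|] := eqVneq (finfun (flux b x')) phi; rewrite ?E ?andbF.
rewrite exchange_big /=; apply: eq_bigr => phi _.
under eq_bigr => x' _ do rewrite forward_push_eq.
rewrite -mulr_suml; congr (_ * _).
rewrite (bigD1 (pull phi x)) //= eqxx andbT big1 ?addr0 // => x' /negbTE ->.
by rewrite andbF.
Qed.

(** * Communicating classes *)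

Lemma f_ge0 (R : realFieldType) (alpha : R) (L : nat) (x y : config L) :
  0 < alpha < 1 -> 0 <= f alpha x y.
Proof.
move=> /andP [a0 a1]; apply: sumr_ge0 => b _; apply: prodr_ge0 => j _.
by case: (b j); rewrite ?subr_ge0 ltW.
Qed.

Lemma f_sum1 (R : realFieldType) (alpha : R) (L : nat) (x : config L) :
  \sum_y f alpha x y = 1.
Proof.
rewrite /f.
transitivity (\sum_(b : {ffun 'I_L -> bool}) bernoulli_weight alpha b).
  by rewrite [RHS](partition_big (fun b => step b x) predT).
rewrite -(bigA_distr_bigA (fun (j : 'I_L) (b : bool) => if b then alpha else 1 - alpha)).
by rewrite big1 // => j _; rewrite big_bool /= addrC subrK.
Qed.

Lemma fn_gt0_connect (R : realFieldType) (alpha : R) (L : nat) (x y : config L) :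
  0 < alpha < 1 ->
  (exists n, 0 < fn alpha n x y) <-> connect [rel x y | 0 < f alpha x y] x y.
Proof.
move=> ha.
have fn_ge0 n u v : 0 <= fn alpha n u v.
  elim: n v => [|n IHn] v /=; first exact: ler0n.
  by apply: sumr_ge0 => z _; rewrite mulr_ge0 ?f_ge0.
split=> [[n]|/connectP [s]].
  elim: n y => [|n IHn] y /=.
    by have [->|] := eqVneq x y; rewrite ?connect0 ?ltxx.
  rewrite lt_def => /andP [+ _]; rewrite psumr_neq0; last first.
    by move=> z _; rewrite mulr_ge0 ?f_ge0.
  move=> /hasP [z _] /=; rewrite lt_def => /andP [+ _].
  rewrite mulf_eq0 negb_or => /andP [n1 n2].
  apply: (connect_trans (IHn z _)); first by rewrite lt_def n1 fn_ge0.
  by apply: connect1; rewrite /= lt_def n2 f_ge0.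
elim/last_ind: s y => [|s z IHs] y /=; first by move=> _ ->; exists 0%N; rewrite /= eqxx ltr01.
rewrite rcons_path last_rcons => /andP [pxs fz] ->.
have [n n_gt0] := IHs _ pxs erefl; exists n.+1 => /=.
rewrite (bigD1 (last x s)) //= ltr_wpDr ?mulr_gt0 //.
by apply: sumr_ge0 => u _; rewrite mulr_ge0 ?f_ge0.
Qed.

(** Accessibility is symmetric, so everything reachable from [x0] is an irreducible set containing
    [Omega]; maximality gives equality. *)
Lemma component_connect (R : realFieldType) (alpha : R) (L : nat)
    (Omega : {set config L}) :
  0 < alpha < 1 -> irreducible_component alpha Omega ->
  exists2 x0, x0 \in Omega &
    Omega = [set y | connect [rel x y | 0 < f alpha x y] x0 y].
Proof.
move=> ha [irr max_irr]; set e := [rel x y | 0 < f alpha x y].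
have a1 : alpha != 1 by rewrite lt_eqF //; case/andP: ha.
have sym : connect_sym e.
  apply: (positive_stationary_connect_sym (P := @f R L alpha) (w := @weight R alpha L)).
  - by move=> x y; apply: f_ge0.
  - exact: f_sum1.
  - by move=> x; apply: weight_gt0.
  - by move=> y; apply: weight_stationary.
have [x0 x0O] : exists x0, x0 \in Omega.
  (* The empty set is vacuously irreducible but not maximal: any singleton is irreducible, through
     [n = 0]. *)
  apply/set0Pn/eqP => Omega0.
  pose x : config L := [ffun=> false].
  suff /setP/(_ x) : [set x] = Omega by rewrite Omega0 !inE eqxx.
  apply: max_irr; last by rewrite Omega0 sub0set.
  by move=> u v; rewrite !inE => /eqP-> /eqP->; exists 0%N; rewrite /= eqxx ltr01.
exists x0 => //; symmetry; apply: max_irr.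
  move=> u v; rewrite !inE => x0u x0v; apply/fn_gt0_connect => //.
  by apply: connect_trans x0v; rewrite sym.
by apply/subsetP => y yO; rewrite inE; apply/fn_gt0_connect => //; apply: irr.
Qed.

(** Counts never exceed [L], so [inord] preserves them and [Omega] can be partitioned by both
    counts. *)
Lemma sum_weight_N (R : realFieldType) (alpha : R) (L : nat)
    (Omega : {set config L}) :
  \sum_(k1 < L.+1) \sum_(k2 < L.+1)
     alpha ^+ k2 / (1 - alpha) ^+ (k1 + k2) * (N Omega k1 k2)%:R =
  \sum_(x in Omega) weight alpha x.
Proof.
have occ_lt w (x : config L) : (occ w x < L.+1)%N.
  by rewrite ltnS -[leqRHS]card_ord max_card.
rewrite (partition_big (fun x : config L => inord (n1110 x) : 'I_L.+1) predT) //=.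
apply: eq_bigr => k1 _.
rewrite (partition_big (fun x : config L => inord (n010 x) : 'I_L.+1) predT) //=.
apply: eq_bigr => k2 _.
have kE w (x : config L) (k : 'I_L.+1) : (inord (occ w x) == k) = (occ w x == k).
  by rewrite -val_eqE /= inordK.
rewrite (eq_bigr (fun=> alpha ^+ k2 / (1 - alpha) ^+ (k1 + k2))); last first.
  by move=> x /andP [/andP [_]]; rewrite !kE /weight /n1110 /n010 => /eqP -> /eqP ->.
rewrite sumr_const -[RHS]mulr_natr; congr (_ * _%:R); apply: eq_card => x.
by rewrite inE -[in RHS]topredE /= !kE andbA.
Qed.

Theorem theorem4p1 (R : realFieldType) (L : nat) (alpha : R)
    (Omega : {set config L}) (hL : (1 <= L)%N) (halpha : 0 < alpha < 1)
    (hOmega : irreducible_component alpha Omega) :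
  exists p : {ffun config L -> R},
    unique (stationary_on alpha Omega) p /\
    forall x : config L, x \in Omega ->
      p x =
        (alpha ^+ n010 x / (1 - alpha) ^+ (n1110 x + n010 x)) /
        (\sum_(k1 < L.+1) \sum_(k2 < L.+1)
           alpha ^+ k2 / (1 - alpha) ^+ (k1 + k2) * (N Omega k1 k2)%:R).
Proof.
have a1 : alpha != 1 by rewrite lt_eqF //; case/andP: halpha.
have P_ge0 (x y : config L) : 0 <= f alpha x y by apply: f_ge0.
have w_gt0 (x : config L) : 0 < weight alpha x by apply: weight_gt0.
have w_stat (x : config L) := weight_stationary x a1.
have sym := positive_stationary_connect_sym P_ge0 (@f_sum1 R alpha L) w_gt0 w_stat.
have [x0 x0O OmegaE] := component_connect halpha hOmega.
rewrite sum_weight_N; set Z := \sum_(x in Omega) _.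
have Z_gt0 : 0 < Z.
  by rewrite /Z (bigD1 x0) //= ltr_wpDr // sumr_ge0 // => x _; apply: ltW.
have conn x y : x \in Omega -> y \in Omega ->
    connect [rel x y | 0 < f alpha x y] x y.
  by rewrite OmegaE !inE => x0x; apply: connect_trans; rewrite sym.
(* [Omega] is a full class of a symmetric relation, so no transition leaves or enters it; hence the
   weight restricted to [Omega] stays stationary. *)
have no_cross x y : (x \in Omega) != (y \in Omega) -> f alpha x y = 0.
  rewrite OmegaE !inE; apply: contraNeq => fxy; apply/eqP.
  have /(same_connect_r sym) -> // : connect [rel x y | 0 < f alpha x y] x y.
  by apply: connect1; rewrite /= lt_def fxy P_ge0.
pose p : {ffun config L -> R} :=
  [ffun x => if x \in Omega then weight alpha x / Z else 0].
have p_stat y : \sum_x f alpha x y * p x = p y.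
  rewrite [RHS]ffunE; case: ifPn => yO.
    rewrite -w_stat mulr_suml; apply: eq_bigr => x _; rewrite ffunE.
    case: ifPn => xO; first by rewrite mulrA.
    by rewrite no_cross ?yO ?(negbTE xO) // !mul0r.
  apply: big1 => x _; rewrite ffunE; case: ifPn => xO; last by rewrite mulr0.
  by rewrite no_cross ?xO ?(negbTE yO) // mul0r.
have p_sum1 : \sum_x p x = 1.
  under eq_bigr => x _ do rewrite ffunE.
  by rewrite -big_mkcond /= -mulr_suml divff ?gt_eqF.
have p_off x : x \notin Omega -> p x = 0.
  by move=> xO; rewrite ffunE (negbTE xO).
have p_gt0 x : x \in Omega -> 0 < p x.
  by move=> xO; rewrite ffunE xO divr_gt0.
exists p; split; last by move=> x xO; rewrite ffunE xO.
split.
  split=> //; split=> //; split=> // x.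
  by have [/p_gt0/ltW //|/p_off ->] := boolP (x \in Omega).
move=> p' [[[_ p'_sum1] p'_stat] p'_off].
have [c cE] := stationary_proportional P_ge0 x0O conn p_gt0 p_off p'_off p_stat p'_stat.
(* Both vectors have total mass 1, which fixes the scalar. *)
have c1 : c = 1.
  by rewrite -p'_sum1 (eq_bigr _ (fun x _ => cE x)) -mulr_sumr p_sum1 mulr1.
by apply/ffunP => x; rewrite cE c1 mul1r.
Qed.
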